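(* Let $\omega>0$ and let $$\mathcal{S}_\ell^{CG}(A_{CG,\ell},b_{CG,\ell},u_{CG,\ell})=u_{CG,\ell}+\omega\,\iota^{CG}_{S_\ell}\,(D^{S_\ell}_{CG,\ell})^{-1}\,(\iota^{CG}_{S_\ell})^*\bigl(b_{CG,\ell}-A_{CG,\ell}u_{CG,\ell}\bigr)$$ be the classical local damped Jacobi smoother on $\mathbb{V}_{CG,\ell}$, where $\iota^{CG}_{S_\ell}$ is the inclusion of the interior-DoF subspace of $\mathbb{V}_{CG,\ell}$ (so that the entries on $E_\ell$ are frozen). Then the cell-wise smoother $$\mathcal{S}_\ell(A_\ell,\tilde b_\ell,u_\ell)=u_\ell+\omega\,\iota_{S_\ell}\,P_\ell^{S_\ell}\,\iota_{S_\ell}^*\bigl(\tilde b_\ell-A_\ell u_\ell\bigr)$$ satisfies, for every $u_{CG}\in\mathbb{V}_{CG,\ell}$ and every $\tilde b_\ell\in\mathbb{V}_{\mathrm{cell},\ell}^*$, $$\mathcal{S}_\ell\bigl(A_\ell,\tilde b_\ell,\mathcal{G}_\ell u_{CG}\bigr)=\mathcal{G}_\ell\,\mathcal{S}_\ell^{CG}\bigl(A_{CG,\ell},\mathcal{G}_\ell^T\tilde b_\ell,u_{CG}\bigr).$$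
   Context: $\mathcal{T}_\ell$ is the set of all cells of refinement level $\ell$ in a locally refined hierarchy of quadrilateral/hexahedral meshes of a domain $\Omega\subset\mathbb{R}^d$; it is a conforming mesh of $\Omega_\ell=\bigcup_{K\in\mathcal{T}_\ell}K\subset\Omega$. Continuous tensor-product elements $\mathbb{Q}_p$ with Gauss–Lobatto nodal basis are used. $\mathbb{V}_{\mathrm{cell},\ell}$ is the broken space of all cell-local coefficient vectors on $\mathcal{T}_\ell$; $\mathbb{V}_{CG,\ell}$ is the space of continuous $\mathbb{Q}_p$ functions on $\mathcal{T}_\ell$ vanishing on $\partial\Omega$, identified with its coefficient vectors. Homogeneous Dirichlet DoFs on $\partial\Omega$ are eliminated: their local copies are zero in gathered vectors and the inverse cell-wise diagonal below is taken to be zero there. The gather $\mathcal{G}_\ell\colon\mathbb{V}_{CG,\ell}\to\mathbb{V}_{\mathrm{cell},\ell}$ replicates each global coefficient into all its cell-local copies; $\mathcal{G}_\ell^T\colon\mathbb{V}_{\mathrm{cell},\ell}^*\to\mathbb{V}_{CG,\ell}^*$ is its transpose (additive assembly). Pairings are Euclidean. The DoFs of $\mathbb{V}_{CG,\ell}$ are partitioned into the refinement edge $E_\ell$ (DoFs on $\partial\Omega_\ell\setminus\partial\Omega$) and the interior $S_\ell$ (all others). $\mathbb{V}_{\mathrm{cell},\ell}^{S_\ell}\subset\mathbb{V}_{\mathrm{cell},\ell}$ is the subspace of vectors vanishing at all cell-local copies of DoFs in $E_\ell$; $\iota_{S_\ell}\colon\mathbb{V}_{\mathrm{cell},\ell}^{S_\ell}\hookrightarrow\mathbb{V}_{\mathrm{cell},\ell}$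 is the inclusion (extension by zero on $E_\ell$) and $\iota_{S_\ell}^*$ its adjoint (dropping the $E_\ell$ entries of a dual vector). Likewise $\iota_{S_\ell}^{CG}$ is the inclusion into $\mathbb{V}_{CG,\ell}$ of the vectors vanishing on $E_\ell$, with adjoint $(\iota_{S_\ell}^{CG})^*$. $A_\ell\colon\mathbb{V}_{\mathrm{cell},\ell}\to\mathbb{V}_{\mathrm{cell},\ell}^*$ is the linear cell-by-cell operator of element integrals (of a symmetric second-order elliptic form, e.g. $\int\nabla u\cdot\nabla v$), and $A_{CG,\ell}=\mathcal{G}_\ell^TA_\ell\mathcal{G}_\ell$. $d_\ell\in\mathbb{V}_{CG,\ell}$ is the vector of (positive) diagonal entries of $A_{CG,\ell}$, $D_{CG,\ell}=\operatorname{diag}(d_\ell)$, $D_{CG,\ell}^{S_\ell}$ its block on $S_\ell$, and $D_{\mathrm{cell},\ell}=\operatorname{diag}(\mathcal{G}_\ell d_\ell)$. Direct stiffness summation is $S=\mathcal{G}_\ell\,\mathcal{I}_{\mathrm{Riesz}}\,\mathcal{G}_\ell^T\colon\mathbb{V}_{\mathrm{cell},\ell}^*\to\mathbb{V}_{\mathrm{cell},\ell}$, with $\mathcal{I}_{\mathrm{Riesz}}\colon\mathbb{V}_{CG,\ell}^*\to\mathbb{V}_{CG,\ell}$ the Euclidean Riesz isomorphism (identity on coefficients). The Jacobi preconditioner is $P_\ell=D_{\mathrm{cell},\ell}^{-1}S$, and $P_\ell^{S_\ell}\colon(\mathbb{V}_{\mathrm{cell},\ell}^{S_\ell})^*\to\mathbb{V}_{\mathrm{cell},\ell}^{S_\ell}$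 is its natural restriction to the interior: extend the dual vector by zero on $E_\ell$ and apply $P_\ell$ (the result vanishes on $E_\ell$). *)

(* Defs.v *)
From HB Require Import structures.
From mathcomp Require Import all_boot all_order all_algebra all_fingroup.
From mathcomp Require Import all_classical all_reals all_analysis.
Set Implicit Arguments.
Unset Strict Implicit.
Unset Printing Implicit Defensive.
Import Order.TTheory GRing.Theory Num.Theory.
Import numFieldNormedType.Exports.
Local Open Scope classical_set_scope.
Local Open Scope ring_scope.

Section CoefficientVectors.
Variable R : realType.

(* [R^o] rather than [R] gives coefficient vectors their canonical vector space
   structure.  Pairings are Euclidean, so a space and its dual are both
   represented by [vec I]. *)
Definition vec (I : finType) := {ffun I -> R^o}.

Definition unit_vec (I : finType) (i : I) : vec I := [ffun k => (k == i)%:R].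

Definition pairing (I : finType) (r v : vec I) : R := \sum_i r i * v i.

Definition transpose (I J : finType) (f : vec J -> vec I) (r : vec I) : vec J :=
  [ffun j => pairing r (f (unit_vec j))].

Lemma pairing_transpose (I J : finType) (f : {linear vec J -> vec I}) r u :
  pairing (transpose f r) u = pairing r (f u).
Proof.
have scE (a : R) (b : R^o) : a *: b = a * b by [].
have {2}-> : u = \sum_j u j *: unit_vec j.
  apply/ffunP => k; rewrite sum_ffunE (bigD1 k)//= !ffunE eqxx scE mulr1.
  rewrite big1 ?addr0// => j jk.
  by rewrite !ffunE scE eq_sym (negPf jk) mulr0.
rewrite linear_sum /pairing; under [RHS]eq_bigr do rewrite sum_ffunE mulr_sumr.
rewrite exchange_big /=; apply: eq_bigr => j _.
rewrite ffunE /pairing mulr_suml; apply: eq_bigr => i _.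
by rewrite linearZ !ffunE scE -mulrA [_ * u j]mulrC.
Qed.

Definition diag_op (I : finType) (v u : vec I) : vec I := [ffun i => v i * u i].

Definition diag_entries (I : finType) (f : vec I -> vec I) : vec I :=
  [ffun i => f (unit_vec i) i].

(* The subspace of vectors vanishing on [E], in coordinates. *)
Definition subvec (I : finType) (E : {set I}) := vec {i : I | i \notin E}.

Definition ext0 (I : finType) (E : {set I}) (v : subvec E) : vec I :=
  [ffun i => if insub i is Some j then v j else 0].

Definition restrict (I : finType) (E : {set I}) (v : vec I) : subvec E :=
  [ffun j => v (val j)].

End CoefficientVectors.

Section Geometry.
Variables (R : realType) (d : nat).
Notation pt := 'rV[R]_d.

Definition boundary (A : set pt) : set pt := closure A `\` interior A.

Definition domain (Omega : set pt) : Prop :=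
  [/\ open Omega, connected Omega, bounded_set Omega & Omega !=set0].

Definition cube : set pt := [set x | forall k, 0 <= x 0 k <= 1].

(* [s k = Some b] pins coordinate [k] to the value [b]; [None] leaves it free. *)
Definition face (s : 'I_d -> option bool) : set pt :=
  [set x | cube x /\ forall k b, s k = Some b -> x 0 k = b%:R].

Definition proper_face (s : 'I_d -> option bool) : Prop :=
  exists k, s k != None.

Definition cube_sym (s : 'S_d) (f : 'I_d -> bool) (x : pt) : pt :=
  \row_k (if f k then 1 - x 0 (s k) else x 0 (s k)).

Definition cell_map (F : pt -> pt) : Prop :=
  [/\ {in cube &, injective F},
      forall x, cube x -> differentiable F x /\ \det (jacobian F x) != 0
    & {within cube, continuous (jacobian F)}].

Record mesh := Mesh {
  cell : finType;
  cmap : cell -> pt -> pt;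
  cmapP : forall K, cell_map (cmap K) }.

Definition cell_set (T : mesh) (K : cell T) : set pt := cmap K @` cube.

Definition mesh_domain (T : mesh) : set pt :=
  [set x | exists K : cell T, cell_set K x].

(* Distinct cells meet in a common face, on which the two parametrizations agree
   up to a symmetry of the reference cube (so that the nodes match). *)
Definition conforming (T : mesh) : Prop :=
  forall K L : cell T, K != L ->
    cell_set K `&` cell_set L = set0 \/
    exists s : 'I_d -> option bool, exists (g : 'S_d) (f : 'I_d -> bool),
      [/\ proper_face s,
          cell_set K `&` cell_set L = cmap K @` face s
        & forall x, face s x -> cmap K x = cmap L (cube_sym g f x)].

(* The part of the boundary of [Omega] in a cell is a union of faces. *)
Definition boundary_fitted (Omega : set pt) (T : mesh) : Prop :=
  forall (K : cell T) x, cube x -> boundary Omega (cmap K x) ->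
    exists s, [/\ proper_face s, face s x
                & cmap K @` face s `<=` boundary Omega].

(* Every cell of [T'] is a child of a cell of [T], and every cell of [T] is
   either not refined or covered by its children. *)
Definition local_refinement (T T' : mesh) : Prop :=
  (forall K' : cell T', exists K : cell T, cell_set K' `<=` cell_set K) /\
  forall K : cell T, (exists K' : cell T', cell_set K' `<=` cell_set K) ->
    cell_set K `<=` [set x | exists2 K' : cell T',
                               cell_set K' `<=` cell_set K & cell_set K' x].

(* A finite hierarchy is extended by empty meshes. *)
Definition mesh_hierarchy (Omega : set pt) (T : nat -> mesh) : Prop :=
  [/\ mesh_domain (T 0%N) = closure Omega,
      forall l, conforming (T l),
      forall l, boundary_fitted Omega (T l)
    & forall l, local_refinement (T l) (T l.+1)].

End Geometry.

Section Elements.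
Variables (R : realType) (d p : nat).
Notation pt := 'rV[R]_d.

(* On [0,1] the Legendre polynomial of degree [p] is a multiple of the [p]-th
   derivative of ('X * ('X - 1)) ^+ p; the Gauss-Lobatto points are the end
   points and the roots of its derivative.  This polynomial has degree [p + 1],
   so its [p + 1] increasing roots are all of its roots. *)
Definition gauss_lobatto_poly : {poly R} :=
  'X * ('X - 1) * (('X * ('X - 1)) ^+ p)^`(p.+1).

Definition gauss_lobatto (xi : 'I_p.+1 -> R) : Prop :=
  (forall i, root gauss_lobatto_poly (xi i)) /\
  (forall i j : 'I_p.+1, (i < j)%N -> xi i < xi j).

Definition lidx := {ffun 'I_d -> 'I_p.+1}.

Variable xi : 'I_p.+1 -> R.

Definition lagrange1 (i : 'I_p.+1) (t : R) : R :=
  \prod_(j | j != i) ((t - xi j) / (xi i - xi j)).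

Definition ref_basis (i : lidx) (y : pt) : R := \prod_k lagrange1 (i k) (y 0 k).

Definition ref_node (i : lidx) : pt := \row_k xi (i k).

(* Integral over R^n, as an iterated Lebesgue integral. *)
Fixpoint rint (n : nat) : ('rV[R]_n -> R) -> R :=
  match n with
  | 0%N => fun f => f 0
  | m.+1 => fun f =>
      (\int[@lebesgue_measure R]_t
         rint (fun y : 'rV[R]_m => f (row_mx (t%:M : 'rV[R]_1) y)))%R
  end.

Definition grad (u : pt -> R^o) (x : pt) : pt :=
  \row_k 'D_(delta_mx 0 k) u x.

(* The form  \int_D (alpha grad u . grad v + gamma u v). *)
Definition form (alpha : pt -> 'M[R]_d) (gamma : pt -> R) (D : set pt)
    (u v : pt -> R) : R :=
  rint (fun x => \1_D x *
    ((grad u x *m alpha x *m (grad v x)^T) 0 0 + gamma x * u x * v x)).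

Definition borel_fun (f : pt -> R) : Prop :=
  forall U : set R, open U -> <<s [set A : set pt | open A] >> (f @^-1` U).

Definition elliptic (Omega : set pt) (alpha : pt -> 'M[R]_d) (gamma : pt -> R) :=
  [/\ forall i j, borel_fun (fun x => alpha x i j),
      borel_fun gamma,
      forall x, Omega x -> (alpha x)^T = alpha x
    & exists m M : R, 0 < m /\ forall x, Omega x ->
        0 <= gamma x <= M /\
        forall v : pt, m * (v *m v^T) 0 0 <= (v *m alpha x *m v^T) 0 0
                       <= M * (v *m v^T) 0 0].

Section Level.
Variables (Omega : set pt) (T : mesh R d).

Definition cdof := (cell T * lidx)%type.

Definition node (c : cdof) : pt := cmap c.1 (ref_node c.2).

(* Global degrees of freedom are the geometric nodes off the boundary of
   [Omega]; the cell-local copies of a DoF are the [c] with that node. *)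
Definition dof := seq_sub [seq node c | c in [pred c | node c \notin boundary Omega]].

Definition Vcell := vec R cdof.
Definition VCG := vec R dof.
Definition Vcell_dual := vec R cdof.
Definition VCG_dual := vec R dof.

(* [None] at the eliminated copies of Dirichlet DoFs. *)
Definition dof_of (c : cdof) : option dof := insub (node c).

Definition gather (u : VCG) : Vcell := [ffun c => oapp u 0 (dof_of c)].

Definition gatherT : Vcell_dual -> VCG_dual := transpose gather.

Definition edge : {set dof} :=
  [set x | val x \in boundary (mesh_domain T) `\` boundary Omega].

Definition edge_cell : {set cdof} :=
  [set c | oapp (fun x => x \in edge) false (dof_of c)].

Definition cell_basis (K : cell T) (i : lidx) (x : pt) : R :=
  ref_basis i (xget 0 [set y | cube y /\ cmap K y = x]).

(* Integrals are over the interior of the cell, where the basis functions are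
   differentiable. *)
Definition cell_op (alpha : pt -> 'M[R]_d) (gamma : pt -> R)
    (u : Vcell) : Vcell_dual :=
  [ffun c => \sum_(j : lidx)
     form alpha gamma (interior (cell_set c.1)) (cell_basis c.1 j) (cell_basis c.1 c.2)
     * u (c.1, j)].

Section Smoothers.
Variable A : Vcell -> Vcell_dual.

Definition CG_op (u : VCG) : VCG_dual := gatherT (A (gather u)).

Definition riesz (r : VCG_dual) : VCG := r.

Definition dss (r : Vcell_dual) : Vcell := gather (riesz (gatherT r)).

Definition Dcell_inv (r : Vcell) : Vcell :=
  [ffun c => if dof_of c is Some _
             then (gather (diag_entries CG_op) c)^-1 * r c else 0].

Definition jacobi (r : Vcell_dual) : Vcell := Dcell_inv (dss r).

(* [ext0] here extends a dual vector; [restrict] only drops entries that vanish,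
   see [ext0_jacobi_int]. *)
Definition jacobi_int (r : subvec R edge_cell) : subvec R edge_cell :=
  restrict edge_cell (jacobi (ext0 r)).

Definition smoother (omega : R) (b : Vcell_dual) (u : Vcell) : Vcell :=
  u + omega *: ext0 (jacobi_int (transpose (@ext0 R _ edge_cell) (b - A u))).

End Smoothers.

Definition D_int (ACG : VCG -> VCG_dual) (v : subvec R edge) : subvec R edge :=
  transpose (@ext0 R _ edge) (diag_op (diag_entries ACG) (ext0 v)).

Definition smoother_CG (omega : R) (ACG : VCG -> VCG_dual) (b : VCG_dual)
    (u : VCG) : VCG :=
  u + omega *: ext0 ((linfun (D_int ACG))^-1%VF
                       (transpose (@ext0 R _ edge) (b - ACG u))).

Lemma ext0_jacobi_int A (r : subvec R edge_cell) :
  ext0 (jacobi_int A r) = jacobi A (ext0 r).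
Proof.
apply/ffunP => c; rewrite !ffunE.
case: insubP => [j _ vj|]; first by rewrite !ffunE vj.
rewrite negbK inE; case E: (dof_of c) => [x|] //= xE.
suff -> : riesz (gatherT (ext0 r)) x = 0 by rewrite mulr0.
rewrite ffunE /pairing big1// => c' _.
have [c'E|c'E] := boolP (c' \in edge_cell); last first.
  rewrite [gather _ _]ffunE; move: c'E; rewrite inE.
  case: (dof_of c') => [x'|] /= x'E; last by rewrite mulr0.
  have x'x : x' != x by apply: contraNneq x'E => ->.
  by rewrite [unit_vec _ _ _]ffunE (negPf x'x) mulr0.
by rewrite ffunE insubN ?mul0r ?negbK.
Qed.

End Level.
End Elements.

(* Main.v *)
(** Zeroing a cell-wise dual vector on the copies of the refinement edge
    commutes with assembly, since all copies of a DoF lie on the same side.  So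
    at a copy of the DoF [x] both corrections are [omega / d x] times the
    assembled residual if [x] is interior, and vanish otherwise. *)
From HB Require Import structures.
Require Import Defs.
From mathcomp Require Import all_boot all_order all_algebra.
From mathcomp Require Import all_classical all_reals all_analysis.
Import Order.TTheory GRing.Theory Num.Theory.
Local Open Scope ring_scope.

Lemma scalevE {R : realType} {I : finType} (a : R) (v : vec R I) (i : I) :
  (a *: v) i = a * v i.
Proof. by rewrite ffunE. Qed.

Lemma pairingBl {R : realType} {I : finType} (r s v : vec R I) :
  pairing (r - s) v = pairing r v - pairing s v.
Proof. by rewrite /pairing -sumrB; apply: eq_bigr => i _; rewrite !ffunE mulrBl. Qed.

Lemma transposeB {R : realType} {I J : finType} (f : vec R J -> vec R I)
    (r s : vec R I) : transpose f (r - s) = transpose f r - transpose f s.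
Proof. by apply/ffunP => j; rewrite !ffunE pairingBl. Qed.

Lemma ext0_val {R : realType} {I : finType} {E : {set I}} (v : subvec R E)
    (j : {i : I | i \notin E}) : ext0 v (val j) = v j.
Proof. by rewrite ffunE valK. Qed.

Lemma ext0_out {R : realType} {I : finType} {E : {set I}} (v : subvec R E)
    (i : I) : i \in E -> ext0 v i = 0.
Proof. by move=> iE; rewrite ffunE insubN // negbK. Qed.

(** Extension by zero sends the unit vector of the subspace at [j] to the unit vector at [val j], so
    pairing with it reads off a single entry of [r]. *)
Lemma transpose_ext0 {R : realType} {I : finType} (E : {set I}) (r : vec R I) :
  transpose (@ext0 R I E) r = Defs.restrict E r.
Proof.
apply/ffunP => j; rewrite !ffunE /pairing (bigD1 (val j)) //=.
rewrite ext0_val ffunE eqxx mulr1 big1 ?addr0 // => i ij.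
have [iE|iE] := boolP (i \in E); first by rewrite ext0_out // mulr0.
rewrite -[i](SubK {i : I | i \notin E} iE) ext0_val ffunE -val_eqE /= (negPf ij).
by rewrite mulr0.
Qed.

Lemma ext0_restrict {R : realType} {I : finType} (E : {set I}) (r : vec R I)
    (i : I) : ext0 (Defs.restrict E r) i = if i \in E then 0 else r i.
Proof.
have [iE|iE] := boolP (i \in E); first exact: ext0_out.
by rewrite -[i](SubK {i : I | i \notin E} iE) ext0_val ffunE.
Qed.

Section Level.
Variables (R : realType) (d p : nat) (xi : 'I_p.+1 -> R).
Variables (Omega : set 'rV[R]_d) (T : mesh R d).

Lemma in_edge_cell (c : cdof p T) (x : dof xi Omega T) :
  dof_of xi Omega c = Some x -> (c \in edge_cell xi Omega T) = (x \in edge xi Omega T).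
Proof. by move=> cx; rewrite inE cx. Qed.

Lemma gatherT_ext0_restrict (r : Vcell_dual p T) :
  gatherT xi Omega (ext0 (Defs.restrict (edge_cell xi Omega T) r))
  = ext0 (Defs.restrict (edge xi Omega T) (gatherT xi Omega r)).
Proof.
apply/ffunP => x; rewrite ext0_restrict.
(* The test on [x] moves inside the assembly sum, so that both sides can be compared copy by
   copy. *)
transitivity (\sum_c (if x \in edge xi Omega T then 0
                      else r c * gather (unit_vec R x) c)); last first.
  by case: ifP => _; [rewrite big1 | rewrite ffunE].
rewrite ffunE /pairing; apply: eq_bigr => c _.
rewrite ext0_restrict [gather _ _]ffunE.
case cy: (dof_of xi Omega c) => [y|] /=; last by rewrite !mulr0 if_same.
rewrite (in_edge_cell _ _ cy) ffunE.
(* Only copies of [x] itself carry weight, and for them the cell-wise mask is the global one. *)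
case: eqP => [->|_]; first by case: ifP; rewrite ?mul0r.
by rewrite !mulr0 if_same.
Qed.

Variable ACG : VCG xi Omega T -> VCG_dual xi Omega T.

Lemma D_intE (v : subvec R (edge xi Omega T)) j :
  D_int ACG v j = diag_entries ACG (val j) * v j.
Proof. by rewrite /D_int transpose_ext0 ffunE [diag_op _ _ _]ffunE ext0_val. Qed.

(** [linfun] reads a function only on a basis; linearity makes it agree with [D_int ACG]
    everywhere. *)
Lemma D_int_linear : linear (D_int ACG).
Proof.
move=> a u v; apply/ffunP => j; rewrite D_intE [RHS]ffunE scalevE.
by rewrite !D_intE (ffunE _ j) scalevE mulrDr mulrCA.
Qed.

HB.instance Definition _ :=
  GRing.isLinear.Build R (subvec R (edge xi Omega T))
    (subvec R (edge xi Omega T)) _ (D_int ACG) D_int_linear.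

(** The inverse of a linear map is a priori a generalized one; nonzero diagonal entries make the
    kernel trivial, hence this endomorphism bijective. *)
Lemma D_int_invE (v : subvec R (edge xi Omega T)) j :
  (forall x, diag_entries ACG x != 0) ->
  ((linfun (D_int ACG))^-1)%VF v j = (diag_entries ACG (val j))^-1 * v j.
Proof.
move=> d_neq0.
have ker0 : lker (linfun (D_int ACG)) == 0%VS.
  apply/lker0P => u w; rewrite !lfunE /= => uw; apply/ffunP => i.
  by apply: (mulfI (d_neq0 (val i))); rewrite -!D_intE uw.
(* Writing the right-hand [v] as the block applied to its preimage lets the diagonal entry
   cancel. *)
by rewrite -{2}(lker0_lfunVK ker0 v) lfunE /= D_intE mulKf.
Qed.

End Level.

Theorem lemma5 (R : realType) (d : nat) (Omega : set 'rV[R]_d)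
    (T : nat -> mesh R d) (l p : nat) (xi : 'I_p.+1 -> R)
    (alpha : 'rV[R]_d -> 'M[R]_d) (gamma : 'rV[R]_d -> R) (omega : R) :
  domain Omega ->
  mesh_hierarchy Omega T ->
  (0 < p)%N ->
  gauss_lobatto xi ->
  elliptic Omega alpha gamma ->
  (forall x : dof xi Omega (T l),
     0 < diag_entries (CG_op (cell_op xi alpha gamma)) x) ->
  0 < omega ->
  forall (u : VCG xi Omega (T l)) (b : Vcell_dual p (T l)),
    smoother xi Omega (cell_op xi alpha gamma) omega b (gather u)
    = gather (smoother_CG omega (CG_op (cell_op xi alpha gamma))
                          (gatherT xi Omega b) u).
Proof.
move=> _ _ _ _ _ d_gt0 _ u b.
rewrite /smoother /smoother_CG ext0_jacobi_int !transpose_ext0.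
move: (cell_op _ _ _) d_gt0 => A d_gt0.
apply/ffunP => c; rewrite ffunE scalevE ![gather _ c]ffunE.
rewrite /jacobi /Dcell_inv (ffunE _ c).
(* At an eliminated Dirichlet copy, gathered vectors and the inverse diagonal are zero by
   convention. *)
case cx: (dof_of xi Omega c) => [x|] /=; last by rewrite mulr0 addr0.
rewrite [RHS]ffunE scalevE; congr (_ + _ * _).
rewrite /dss ![gather _ c]ffunE cx /= /riesz.
rewrite gatherT_ext0_restrict.
have [xE|xE] := boolP (x \in edge xi Omega (T l)).
  by rewrite !ext0_out // mulr0.
(* Only the two points where [ext0] is evaluated become interior indices; the diagonal entry keeps
   [x]. *)
rewrite -{2 3}[x](SubK {x : dof xi Omega (T l) | x \notin edge xi Omega (T l)} xE).
rewrite !ext0_val D_int_invE => [|y]; last by rewrite gt_eqF.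
(* By additivity of assembly, the assembled cell-wise residual is the global one, [CG_op] being the
   assembly of [A (gather u)]. *)
by rewrite SubK /gatherT transposeB.
Qed.
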